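(* For every integer $n\ge0$, the composite map $\sigma\circ\pi\colon\mathcal P_n\to\mathcal P_n$ sends each partition $\lambda$ of $n$ to its conjugate partition $\lambda^*$.
   Context: $\mathcal P$ is the set of integer partitions (including the empty one), $\mathcal P_n$ the partitions of $n$. A partition $\phi=(\phi_1,\dots,\phi_r)$ is sequentially congruent if $\phi_i\equiv\phi_{i+1}\pmod i$ for $1\le i\le r-1$ and $\phi_r\equiv0\pmod r$; $\mathcal S$ denotes the set of such partitions. The map $\pi\colon\mathcal P\to\mathcal S$ sends $\lambda=(\lambda_1,\dots,\lambda_r)$ to $\pi(\lambda)=(\lambda'_1,\dots,\lambda'_r)$ with $\lambda'_i=i\lambda_i+\sum_{j=i+1}^r\lambda_j$. The map $\sigma\colon\mathcal S\to\mathcal P$ sends $\phi=(\phi_1,\dots,\phi_r)\in\mathcal S$ (with $\phi_k=0$ for $k>r$) to the partition in which each $i\ge1$ occurs with multiplicity $(\phi_i-\phi_{i+1})/i$, i.e. $\sigma(\phi)=(1^{\phi_1-\phi_2}\,2^{(\phi_2-\phi_3)/2}\,3^{(\phi_3-\phi_4)/3}\cdots)$. The conjugate $\lambda^*$ of $\lambda$ is the partition whose Ferrers–Young diagram is the transpose of that of $\lambda$. *)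

(* Defs.v *)
From HB Require Import structures.
From mathcomp Require Import all_boot.

Set Implicit Arguments.
Unset Strict Implicit.
Unset Printing Implicit Defensive.

(* A partition is the weakly decreasing list of its positive parts.  Indices  *)
(* are 0-based: the part written la_(i.+1) on paper is nth 0 la i, and the    *)
(* default value of nth implements the convention la_k = 0 for k > size la.   *)
Definition is_intpart (s : seq nat) : bool := sorted geq s && (0 \notin s).

Record intpart := IntPart {parts :> seq nat; partsP : is_intpart parts}.

HB.instance Definition _ := [isSub for parts].
HB.instance Definition _ := [Equality of intpart by <:].

Definition intparts_of (n : nat) : pred intpart :=
  [pred la : intpart | sumn la == n].

(* At the last index i = size phi - 1 the congruence reads phi_r = 0 mod r.   *)
Definition is_seqcong (phi : intpart) : bool :=
  all (fun i => nth 0 phi i == nth 0 phi i.+1 %[mod i.+1]) (iota 0 (size phi)).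

Record seqcong :=
  SeqCong {seqcong_part :> intpart; seqcongP : is_seqcong seqcong_part}.

Lemma nth_intpart_geq (la : intpart) i j :
  i <= j -> nth 0 la j <= nth 0 la i.
Proof.
case: la => s /= /andP[s_sorted _] le_ij.
have [lt_js|le_sj] := ltnP j (size s); last by rewrite (nth_default _ le_sj).
have gt : transitive geq by move=> y x z /= xy yz; apply: leq_trans yz xy.
have gr : reflexive geq by move=> x /=.
by apply: (sorted_leq_nth gt gr 0 s_sorted) => //; apply: leq_ltn_trans lt_js.
Qed.

Lemma nth_intpart_gt0 (la : intpart) i : (0 < nth 0 la i) = (i < size la).
Proof.
case: la => s /= /andP[_ s0].
have [lt_is|le_si] := ltnP i (size s); last by rewrite nth_default.
by rewrite lt0n; apply: contraNneq s0 => <-; rewrite mem_nth.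
Qed.

Lemma eq_intpart (la mu : intpart) :
  (forall i, nth 0 la i = nth 0 mu i) -> la = mu.
Proof.
move=> eq_lm; have eq_lt i : (i < size la) = (i < size mu).
  by rewrite -!nth_intpart_gt0 eq_lm.
have eq_sz : size la = size mu.
  by apply/eqP; rewrite eqn_leq leqNgt eq_lt ltnn leqNgt -eq_lt ltnn.
by apply: val_inj; apply: (eq_from_nth (x0 := 0)).
Qed.

Lemma is_intpart_mkseq (f : nat -> nat) n :
    (forall i, i.+1 < n -> f i.+1 <= f i) -> (forall i, i < n -> 0 < f i) ->
  is_intpart (mkseq f n).
Proof.
move=> f_decr f_gt0; apply/andP; split.
  apply/(sortedP 0) => i; rewrite size_mkseq => lt_in.
  by rewrite !nth_mkseq ?(ltnW lt_in) //=; apply: f_decr.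
by apply/negP => /mapP[i]; rewrite mem_iota add0n => /f_gt0 /[swap] <-.
Qed.

Definition pi_seq (la : seq nat) : seq nat :=
  mkseq (fun i => i.+1 * nth 0 la i + \sum_(i.+1 <= j < size la) nth 0 la j)
        (size la).

Lemma pi_seq_intpart (la : intpart) : is_intpart (pi_seq la).
Proof.
apply: is_intpart_mkseq => i lt_i; last first.
  by rewrite addn_gt0 muln_gt0 nth_intpart_gt0 lt_i.
rewrite [in leqRHS]big_ltn // addnA leq_add2r mulSnr leq_add2r leq_mul2l.
by rewrite nth_intpart_geq.
Qed.

Definition pi_part (la : intpart) : intpart := IntPart (pi_seq_intpart la).

Lemma pi_part_seqcong (la : intpart) : is_seqcong (pi_part la).
Proof.
apply/allP => i; rewrite mem_iota size_mkseq add0n => /= lt_i.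
rewrite nth_mkseq //; have [lt_Si|le_Si] := ltnP i.+1 (size la).
  rewrite nth_mkseq // big_ltn // mulnC modnMDl.
  by rewrite (mulSnr i.+1) -addnA mulnC modnMDl.
rewrite [X in _ == X %% _]nth_default ?size_mkseq //.
by rewrite big_geq // addn0 mod0n modnMr.
Qed.

Definition pi_map (la : intpart) : seqcong := SeqCong (pi_part_seqcong la).

(* sigma_mult phi i is (phi_i - phi_(i.+1)) / i with the indices of the paper *)
(* notation; sigma_multP shows that for phi in seqcong neither the natural    *)
(* number subtraction nor the division truncates.                             *)
Definition sigma_mult (phi : seq nat) (i : nat) : nat :=
  (nth 0 phi i.-1 - nth 0 phi i) %/ i.

Definition sigma_seq (phi : seq nat) : seq nat :=
  flatten [seq nseq (sigma_mult phi i) i | i <- rev (iota 1 (size phi))].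

Lemma sigma_seq_intpart (phi : seqcong) : is_intpart (sigma_seq phi).
Proof.
rewrite /is_intpart /sigma_seq; move: (sigma_mult phi) (size phi) => m r.
have memP k x : x \in flatten [seq nseq (m i) i | i <- rev (iota 1 k)] ->
    0 < x <= k.
  case/flatten_mapP=> i; rewrite mem_rev mem_iota add1n ltnS.
  by move=> i_le; rewrite mem_nseq => /andP[_ /eqP->].
apply/andP; split; last by apply/negP => /memP.
have gt : transitive geq by move=> y x z /= xy yz; apply: leq_trans yz xy.
rewrite sorted_pairwise //; elim: r => [|r IHr] //.
rewrite -{1}[r.+1]addn1 iotaD add1n rev_cat /= pairwise_cat IHr andbT.
apply/andP; split.
  apply/allrelP => x y; rewrite mem_nseq => /andP[_ /eqP->] /memP/andP[_].
  exact: leqW.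
by elim: (m _) => //= k ->; rewrite all_nseq /= leqnn orbT.
Qed.

Definition sigma_map (phi : seqcong) : intpart := IntPart (sigma_seq_intpart phi).

Lemma count_mem_sigma (phi : seqcong) i :
  0 < i -> count_mem i (sigma_map phi) = sigma_mult phi i.
Proof.
move=> i_gt0; have -> : sigma_mult phi i =
    (if i <= size phi then sigma_mult phi i else 0).
  case: leqP => //; case: i i_gt0 => // i _; rewrite ltnS => le_i.
  by rewrite /sigma_mult !nth_default ?div0n // leqW.
rewrite /= /sigma_seq; move: (sigma_mult phi) (size phi) => m r.
elim: r => [|r IHr]; first by rewrite leqNgt i_gt0.
rewrite -{1}[r.+1]addn1 iotaD add1n rev_cat /= count_cat IHr count_nseq /=.
have [lt_ir|gt_ir|->] := ltngtP i r.+1; last 1 first.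
- by rewrite mul1n ltnn addn0.
- by rewrite mul0n -ltnS lt_ir.
- by rewrite mul0n leqNgt (ltnW gt_ir).
Qed.

Lemma sigma_multP (phi : seqcong) i :
  0 < i -> nth 0 phi i.-1 = nth 0 phi i + i * sigma_mult phi i.
Proof.
case: i => //= i _; have le_phi := nth_intpart_geq phi (leqnSn i).
rewrite mulnC divnK ?subnKC // -eqn_mod_dvd //.
have [lt_i|le_i] := ltnP i (size phi).
  by apply: (allP (seqcongP phi)); rewrite mem_iota.
by rewrite !nth_default // ltnW.
Qed.

(* The cell (i, j) lies in row i and column j, both counted from 0.           *)
Definition ferrers (la : intpart) : pred (nat * nat) :=
  [pred c | c.2 < nth 0 la c.1].

(* Row j of the transposed diagram is column j of the diagram of la.          *)
Definition conj_seq (la : seq nat) : seq nat :=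
  mkseq (fun j => count (fun x => j < x) la) (head 0 la).

Lemma conj_seq_intpart (la : intpart) : is_intpart (conj_seq la).
Proof.
apply: is_intpart_mkseq => j lt_j.
  by apply: sub_count => x; apply: ltnW.
rewrite -has_count; case: la lt_j => -[|x s] //= _ lt_j.
by rewrite lt_j.
Qed.

Definition conj_part (la : intpart) : intpart := IntPart (conj_seq_intpart la).

Lemma count_intpart_gt (la : intpart) i j :
  (i < count (fun x => j < x) la) = (j < nth 0 la i).
Proof.
case: la => s /= /andP[+ _].
have gt : transitive geq by move=> y x z /= xy yz; apply: leq_trans yz xy.
rewrite sorted_pairwise //; elim: s i => [|x s IHs] [|i] //= /andP[xs srt].
  have [//|le_xj] := ltnP j x; rewrite add0n -has_count.
  apply/hasPn => y /(allP xs) /= le_yx.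
  by rewrite -leqNgt (leq_trans le_yx).
have [lt_jx|le_xj] := ltnP j x; first by rewrite add1n ltnS IHs.
rewrite add0n; have -> : count (fun y => j < y) s = 0.
  apply/eqP; rewrite -leqn0 leqNgt -has_count.
  by apply/hasPn => y /(allP xs) /= le_yx; rewrite -leqNgt (leq_trans le_yx).
rewrite ltn0; apply/esym/negbTE; rewrite -leqNgt.
have [lt_is|le_si] := ltnP i (size s); last by rewrite nth_default.
by apply: leq_trans le_xj; apply: (allP xs); rewrite mem_nth.
Qed.

Lemma ferrers_conj (la : intpart) i j :
  ((i, j) \in ferrers (conj_part la)) = ((j, i) \in ferrers la).
Proof.
rewrite !inE /=; have [lt_i|le_i] := ltnP i (head 0 la).
  by rewrite nth_mkseq // count_intpart_gt.
rewrite nth_default ?size_mkseq // ltn0; apply/esym/negbTE; rewrite -leqNgt.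
by apply: leq_trans le_i; rewrite -nth0 nth_intpart_geq.
Qed.

Lemma ferrers_inj (la mu : intpart) : ferrers la =i ferrers mu -> la = mu.
Proof.
move=> eq_f; apply: eq_intpart => i; apply/eqP; rewrite eqn_leq.
have := eq_f (i, nth 0 la i); have := eq_f (i, nth 0 mu i).
by rewrite !inE /= !ltnn !ltnNge => /negbFE-> /esym/negbFE->.
Qed.

(* Main.v *)
(* The i-th multiplicity of sigma (pi la) is la_i - la_(i+1): in               *)
(* pi(la)_i - pi(la)_(i+1) the tails cancel and leave i (la_i - la_(i+1)).     *)
(* This is also the number of columns of length exactly i in the diagram of    *)
(* la, that is, the multiplicity of i in the conjugate partition.              *)
Require Import Defs.
From HB Require Import structures.
From mathcomp Require Import all_boot.

(** Multiplicities determine a partition, and on both sides [i.+1] has multiplicity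
    [nth 0 la i - nth 0 la i.+1]: by [sigma_mult_pi_seq] for the composite, by [count_mem_succ] and
    [count_gt_conj_part] for the conjugate. *)

Lemma eq_intpart_count_mem (la mu : intpart) :
  (forall i, 0 < i -> count_mem i la = count_mem i mu) -> la = mu.
Proof.
case: la mu => s sP [t tP] /= eq_st; apply: val_inj => /=.
case/andP: sP tP => s_sorted s0 /andP[t_sorted t0].
have gt : transitive geq by move=> y x z /= xy yz; apply: leq_trans yz xy.
have ga : antisymmetric geq by move=> x y /= /anti_leq.
apply: (sorted_eq gt ga) => //; apply/allP => -[|i] _ /=; last by rewrite eq_st.
by rewrite (count_memPn s0) (count_memPn t0).
Qed.

Lemma count_mem_succ (s : seq nat) i :
  count_mem i.+1 s = count (fun x => i < x) s - count (fun x => i.+1 < x) s.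
Proof.
suff -> : count (fun x => i < x) s =
    count_mem i.+1 s + count (fun x => i.+1 < x) s by rewrite addnK.
elim: s => //= x s ->; rewrite addnACA; congr (_ + _).
by rewrite [i < x]leq_eqVlt eq_sym; case: ltngtP.
Qed.

(** The parts of the conjugate exceeding [i] are the columns of [la] that meet row [i]. *)
Lemma count_gt_conj_part (la : intpart) i :
  count (fun x => i < x) (conj_part la) = nth 0 la i.
Proof.
have lt_iff k : (k < count (fun x => i < x) (conj_part la)) = (k < nth 0 la i).
  by rewrite count_intpart_gt; have := ferrers_conj la k i; rewrite !inE.
apply/eqP; rewrite eqn_leq.
by rewrite leqNgt lt_iff ltnn leqNgt -lt_iff ltnn.
Qed.

Lemma sigma_mult_pi_seq (la : seq nat) i :
  sigma_mult (pi_seq la) i.+1 = nth 0 la i - nth 0 la i.+1.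
Proof.
rewrite /sigma_mult /=; have [lt_i|le_i] := ltnP i (size la); last first.
  by rewrite !nth_default ?size_mkseq ?div0n // leqW.
rewrite nth_mkseq //; have [lt_Si|le_Si] := ltnP i.+1 (size la).
  rewrite nth_mkseq // big_ltn //= addnA subnDr (mulSnr i.+1) subnDr.
  by rewrite -mulnBr mulKn.
(* At the last index the tail sum is empty and both next entries are 0. *)
rewrite !(nth_default 0 (n := i.+1)) ?size_mkseq // big_geq //.
by rewrite addn0 !subn0 mulKn.
Qed.

(** Double counting of the cells, by columns and by rows. *)
Lemma sumn_conj_part (la : intpart) : sumn (conj_part la) = sumn la.
Proof.
have le_head x : x \in parts la -> x <= head 0 la.
  by case/(nthP 0) => i _ <-; rewrite -nth0 nth_intpart_geq.
rewrite /= /conj_seq; move: (head 0 la) le_head => m.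
rewrite !sumnE big_map => le_m.
under eq_bigr do rewrite -sum1_count big_mkcond.
rewrite exchange_big /=; apply: eq_big_seq => x /le_m le_xm.
rewrite -big_mkcond sum1_count.
by rewrite -size_filter -[x]add0n filter_iota_ltn // size_iota.
Qed.

Theorem theorem3p1 (n : nat) (la : intpart) (la_n : la \in intparts_of n) :
  sigma_map (pi_map la) \in intparts_of n /\ sigma_map (pi_map la) = conj_part la.
Proof.
suff eq_conj : sigma_map (pi_map la) = conj_part la.
  by split=> //; rewrite eq_conj inE sumn_conj_part.
apply: eq_intpart_count_mem => -[|i] // i_gt0.
rewrite count_mem_sigma // sigma_mult_pi_seq.
by rewrite count_mem_succ !count_gt_conj_part.
Qed.
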